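(* The corrected pressure-based DG semi-discretization $$\sum_{j=1}^{n_b}\mathcal{M}_{kj}\frac{d\widehat{\boldsymbol{y}}_j}{dt}+\widetilde{\boldsymbol{\mathcal{R}}}_k+\boldsymbol{r}_k=0,\qquad k=1,\dots,n_b,$$ with correction term $\boldsymbol{r}_k=\alpha(\widehat{\boldsymbol{w}}_k-\overline{\boldsymbol{w}})$, is neither velocity-equilibrium-preserving nor pressure-equilibrium-preserving. It also does not preserve zero species concentrations.
   Context: Definitions of the properties: the semi-discretization is velocity-equilibrium-preserving (resp. pressure-equilibrium-preserving) if, for the considered class of mixtures and discretizations, whenever at some time the pressure and velocity are constant ($P\equiv P_0$, $\boldsymbol{v}\equiv\boldsymbol{v}_0$), one has $\partial_t\boldsymbol{v}=0$ (resp. $\partial_tP=0$), where $\partial_t\boldsymbol{v}=\frac1\rho\partial_t(\rho\boldsymbol{v})-\frac{\boldsymbol{v}}{\rho}\partial_t\rho$. It preserves zero species concentrations if $C_i\equiv0$ at some time implies $\partial_tC_i=0$ at that time. The claim is that these properties fail in general. State: $\boldsymbol{y}=(\rho v_1,\dots,\rho v_d,P,C_1,\dots,C_{n_s})^T\in\mathbb{R}^m$, with $\boldsymbol{v}$ velocity, $P$ pressure, $C_i$ molar concentrations, $W_i$ molar masses, $\rho=\sum_iW_iC_i>0$. Mixture of thermally perfect gases: $P=R^0T\sum_iC_i$, with $R^0$ the universal gas constant, $\rho u=\sum_iW_iC_iu_i(T)$, $u_i(T)=h_{\mathrm{ref},i}+\int_{T_{\mathrm{ref}}}^Tc_{p,i}(\tau)d\tau-(R^0/W_i)T$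 with $c_{p,i}$ polynomial in temperature, $\rho e_t=\rho u+\frac12\rho\,\boldsymbol{v}\cdot\boldsymbol{v}$; $\rho c_v=\sum_iW_iC_i(c_{p,i}-R^0/W_i)$; $c^2=\gamma P/\rho$ with $\gamma$ the mixture specific heat ratio. Uncorrected residual: with $\boldsymbol{y}=\sum_{j=1}^{n_b}\widehat{\boldsymbol{y}}_j\phi_j$ on an element $\kappa$ ($\{\phi_j\}$ a basis of $\mathcal{P}_p(\kappa)$, polynomials of degree at most $p$; a nodal basis is used) and $\mathcal{M}_{ij}=\int_\kappa\phi_i\phi_jdx$, $$\widetilde{\boldsymbol{\mathcal{R}}}_k=\oint_{\partial\kappa}\phi_k\boldsymbol{\mathcal{F}}^\dagger ds-\int_\kappa\nabla\phi_k\cdot\boldsymbol{\mathcal{F}}(\boldsymbol{y})dx+\oint_{\partial\kappa}\phi_k\boldsymbol{\mathcal{D}}\,ds+\int_\kappa\phi_k\,\boldsymbol{\mathcal{B}}(\boldsymbol{y}):\nabla\boldsymbol{y}\,dx.$$ Here $\boldsymbol{\mathcal{F}}_k(\boldsymbol{y})=(\rho v_kv_1+P\delta_{k1},\dots,\rho v_kv_d+P\delta_{kd},Pv_k,v_kC_1,\dots,v_kC_{n_s})^T$; $\boldsymbol{\mathcal{F}}^\dagger=\tfrac12(\boldsymbol{\mathcal{F}}(\boldsymbol{y}^+)+\boldsymbol{\mathcal{F}}(\boldsymbol{y}^-))\cdot\boldsymbol{n}+\tfrac12\lambda(\boldsymbol{y}^+-\boldsymbol{y}^-)$ ($\lambda$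 a wave speed estimate, $\boldsymbol{n}$ outward normal, $\boldsymbol{y}^+$ interior trace, $\boldsymbol{y}^-$ neighbor trace; all faces interior); $\boldsymbol{\mathcal{B}}(\boldsymbol{y}):\nabla\boldsymbol{y}$ has only a nonzero pressure component, $\boldsymbol{\mathcal{B}}_P(\boldsymbol{y}):\nabla\boldsymbol{y}=(\rho c^2-P)\nabla\cdot\boldsymbol{v}$, with $\boldsymbol{\mathcal{B}}_{P,k}=\frac{\rho c^2-P}{\rho}(\delta_{k1},\dots,\delta_{kd},0,-W_1v_k,\dots,-W_{n_s}v_k)^T$; $\boldsymbol{\mathcal{D}}$ has only a nonzero pressure component $\mathcal{D}_P=\tfrac12(\boldsymbol{\mathcal{B}}_P\cdot\boldsymbol{n})|_{(\boldsymbol{y}^++\boldsymbol{y}^-)/2}\cdot(\boldsymbol{y}^--\boldsymbol{y}^+)$. Correction: with $$\boldsymbol{w}=\frac{\partial(\rho e_t)}{\partial\boldsymbol{y}}=\Big(v_1,\dots,v_d,\ \tfrac{\rho c_v}{R^0\sum_jC_j},\ \big(W_iu_i-\tfrac{\rho c_vP}{R^0(\sum_jC_j)^2}-\tfrac{W_i}{2}\boldsymbol{v}\cdot\boldsymbol{v}\big)_{i=1}^{n_s}\Big)^T,$$ $\widehat{\boldsymbol{w}}_k\in\mathbb{R}^m$ are the coefficients of the quadrature-based $L^2$ projection of $\boldsymbol{w}$ onto $[\mathcal{P}_p(\kappa)]^m$, that is $\widehat{\boldsymbol{w}}=\mathcal{M}^{-1}\boldsymbol{V}_q^T\boldsymbol{W}\boldsymbol{w}(\boldsymbol{y}_q)$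 for a quadrature rule with points $\boldsymbol{x}_{q,i}$, weights $\omega_{q,i}$, $\boldsymbol{W}=\mathrm{diag}(\omega_{q,i})$, $(V_q)_{ij}=\phi_j(\boldsymbol{x}_{q,i})$, $\boldsymbol{y}_q=\boldsymbol{V}_q\widehat{\boldsymbol{y}}$; $\overline{\boldsymbol{w}}=\frac1{n_b}\sum_k\widehat{\boldsymbol{w}}_k$; and $$\alpha=\frac{\oint_{\partial\kappa}\mathcal{F}^\dagger_{\rho e_t}ds-\sum_k\widehat{\boldsymbol{w}}_k^T\widetilde{\boldsymbol{\mathcal{R}}}_k}{\sum_k(\widehat{\boldsymbol{w}}_k-\overline{\boldsymbol{w}})^T(\widehat{\boldsymbol{w}}_k-\overline{\boldsymbol{w}})},$$ with $\mathcal{F}^\dagger_{\rho e_t}=\tfrac12\big(\boldsymbol{\mathcal{F}}_{\rho e_t}(\boldsymbol{y}^+)+\boldsymbol{\mathcal{F}}_{\rho e_t}(\boldsymbol{y}^-)\big)\cdot\boldsymbol{n}+\tfrac12\lambda\big((\rho e_t)^+-(\rho e_t)^-\big)$ and $\boldsymbol{\mathcal{F}}_{\rho e_t}(\boldsymbol{y})=\boldsymbol{v}(\rho e_t+P)$. *)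

(* Defs.v *)
From HB Require Import structures.
From mathcomp Require Import all_boot all_order all_algebra.
From mathcomp Require Import all_classical all_reals all_analysis.
(* The notations of multinomials clash with those of MathComp-Analysis. *)
From mathcomp Require Import -(notations) mpoly.
Set Implicit Arguments.
Unset Strict Implicit.
Unset Printing Implicit Defensive.
Import Order.TTheory GRing.Theory Num.Theory.
Local Open Scope classical_set_scope.
Local Open Scope ring_scope.

Section Integrals.
Variable R : realType.

Definition dot n (u v : 'rV[R]_n) : R := \sum_i u 0 i * v 0 i.

(* Oriented integral: int_a^b = - int_b^a when b < a. *)
Definition oriented_int (a b : R) (f : R -> R) : R :=
  if a <= b then \int[lebesgue_measure]_(t in `[a, b]) f t
  else - \int[lebesgue_measure]_(t in `[b, a]) f t.

(* Integral over R^n, as an iterated Lebesgue integral; for n = 0 it is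
   integration against the unit mass on the one-point space. *)
Fixpoint int_Rn n : ('rV[R]_n -> R) -> R :=
  match n return ('rV[R]_n -> R) -> R with
  | 0 => fun f => f 0
  | n'.+1 => fun f => \int[lebesgue_measure]_t
      int_Rn (fun v : 'rV[R]_n' => f (row_mx (t%:M : 'rV[R]_1) v))
  end.

(* Convex polytope {x | nrm f . x <= off f for every face f}. *)
Record cell (d : nat) := Cell {
  face : finType;
  nrm : face -> 'rV[R]_d;
  off : face -> R }.

Variable d : nat.
Implicit Types K : cell d.

Definition pts K : set 'rV[R]_d :=
  [set x | forall f : face K, dot (nrm f) x <= off f].

Definition open_pts K : set 'rV[R]_d :=
  [set x | forall f : face K, dot (nrm f) x < off f].

Definition facet K (f : face K) : set 'rV[R]_d :=
  [set x | pts K x /\ dot (nrm f) x = off f].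

(* The last clause says that every listed face is a genuine facet, listed
   once; the nrm f are then the outward unit normals of the facets. *)
Definition wf_cell K : Prop :=
  [/\ exists x, open_pts K x,
      exists r : R, forall x, pts K x -> forall i, `|x 0 i| <= r,
      forall f : face K, dot (nrm f) (nrm f) = 1 &
      forall f : face K, exists2 x, dot (nrm f) x = off f &
        forall g : face K, g != f -> dot (nrm g) x < off g].

Definition cell_int K (g : 'rV[R]_d -> R) : R :=
  int_Rn (fun x => \1_(pts K) x * g x).

(* The point of the hyperplane n . x = b whose coordinates other than the i-th
   are given by v (n 0 i must be nonzero). *)
Definition hyperplane_pt (n : 'rV[R]_d) (b : R) (i : 'I_d) (v : 'rV[R]_d.-1) :
    'rV[R]_d :=
  \row_j (if unlift i j is Some j' then v 0 j'
          else (b - \sum_j' n 0 (lift i j') * v 0 j') / n 0 i).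

(* Surface integral over a facet: the facet is a graph over the coordinates
   other than i, with n 0 i <> 0, and ds = dv / |n 0 i| for a unit normal n
   (the value does not depend on i).  For d = 1 it is evaluation at the
   end point. *)
Definition facet_int K (f : face K) (g : 'rV[R]_d -> R) : R :=
  if [pick i | nrm f 0 i != 0] is Some i then
    int_Rn (fun v : 'rV[R]_d.-1 =>
      let x := hyperplane_pt (nrm f) (off f) i v in \1_(pts K) x * g x)
      / `|nrm f 0 i|
  else 0.

Definition boundary_int K (g : face K -> 'rV[R]_d -> R) : R :=
  \sum_(f : face K) facet_int f (g f).

Definition cell_intv m K (g : 'rV[R]_d -> 'rV[R]_m) : 'rV[R]_m :=
  \row_a cell_int K (fun x => g x 0 a).

Definition boundary_intv m K (g : face K -> 'rV[R]_d -> 'rV[R]_m) : 'rV[R]_m :=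
  \row_a boundary_int (fun f x => g f x 0 a).

Definition ev (q : mpoly d R) (x : 'rV[R]_d) : R := meval (x 0) q.

Definition grad (q : mpoly d R) (x : 'rV[R]_d) : 'rV[R]_d :=
  \row_k ev (mderiv k q) x.

(* Membership in P_p: msize is the total degree plus one. *)
Definition deg_le (p : nat) (q : mpoly d R) : Prop :=
  (mmeasure mdeg q <= p.+1)%N.

End Integrals.

Arguments cell_intv {R d m} K g.

Section Physics.
Variables (R : realType) (R0 : R) (d ns : nat).

(* y = (rho v_1, ..., rho v_d, P, C_1, ..., C_ns) *)
Definition state := 'rV[R]_(d + 1 + ns).
Implicit Types y : state.

Definition mk_state (a : 'rV[R]_d) (b : R) (c : 'rV[R]_ns) : state :=
  row_mx (row_mx a (b%:M : 'rV[R]_1)) c.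
Definition mom y : 'rV[R]_d := lsubmx (lsubmx y).
Definition pres y : R := (rsubmx (lsubmx y) : 'rV[R]_1) 0 0.
Definition conc y : 'rV[R]_ns := rsubmx y.

Record mixture := Mixture {
  molar_mass : 'I_ns -> R;
  href : 'I_ns -> R;
  Tref : R;
  cp : 'I_ns -> {poly R} }.

Variable X : mixture.
Local Notation W := (molar_mass X).

Definition wf_mixture : Prop := 0 < Tref X /\ forall i, 0 < W i.

Definition rho y : R := \sum_i W i * conc y 0 i.
Definition csum y : R := \sum_i conc y 0 i.
Definition vel y : 'rV[R]_d := (rho y)^-1 *: mom y.
Definition temp y : R := pres y / (R0 * csum y).

Definition uspec (i : 'I_ns) (T : R) : R :=
  href X i + oriented_int (Tref X) T (fun t => (cp X i).[t]) - R0 / W i * T.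

Definition rho_et y : R :=
  \sum_i W i * conc y 0 i * uspec i (temp y)
  + 2^-1 * rho y * dot (vel y) (vel y).
Definition rho_cp y : R := \sum_i W i * conc y 0 i * (cp X i).[temp y].
Definition rho_cv y : R :=
  \sum_i W i * conc y 0 i * ((cp X i).[temp y] - R0 / W i).
Definition gamma y : R := rho_cp y / rho_cv y.
Definition sound2 y : R := gamma y * pres y / rho y.

(* cp_i > R0 / W_i says that each species has a positive specific heat at
   constant volume at the temperature of the state. *)
Definition physical y : Prop :=
  [/\ 0 < rho y, 0 < pres y, forall i, 0 <= conc y 0 i &
      forall i, R0 / W i < (cp X i).[temp y]].

Definition flux (k : 'I_d) y : state :=
  mk_state (vel y 0 k *: mom y + pres y *: delta_mx 0 k)
           (pres y * vel y 0 k) (vel y 0 k *: conc y).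

Definition flux_n y (n : 'rV[R]_d) : state := \sum_k n 0 k *: flux k y.

Definition energy_flux_n y (n : 'rV[R]_d) : R :=
  dot (vel y) n * (rho_et y + pres y).

Definition BP (k : 'I_d) y : state :=
  ((rho y * sound2 y - pres y) / rho y) *:
  mk_state (delta_mx 0 k) 0 (\row_i - (W i * vel y 0 k)).

(* Vector whose only nonzero component is the pressure one. *)
Definition in_pres (s : R) : state := mk_state 0 s 0.

(* dy k is the derivative of y in direction k. *)
Definition B_grad y (dy : 'I_d -> state) : state :=
  in_pres (\sum_k dot (BP k y) (dy k)).

(* In the four face terms, yp is the interior and ym the neighbor trace, and
   n is the outward unit normal. *)
Definition D_term (yp ym : state) (n : 'rV[R]_d) : state :=
  in_pres (2^-1 *
    dot (\sum_k n 0 k *: BP k (2^-1 *: (yp + ym))) (ym - yp)).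

Variable lam : state -> state -> 'rV[R]_d -> R.

Definition num_flux (yp ym : state) (n : 'rV[R]_d) : state :=
  2^-1 *: (flux_n yp n + flux_n ym n) + (2^-1 * lam yp ym n) *: (yp - ym).

Definition num_energy_flux (yp ym : state) (n : 'rV[R]_d) : R :=
  2^-1 * (energy_flux_n yp n + energy_flux_n ym n)
  + 2^-1 * lam yp ym n * (rho_et yp - rho_et ym).

(* lam bounds the acoustic wave speeds |v . n| + c of both traces. *)
Definition wave_speed_estimate : Prop :=
  forall (yp ym : state) (n : 'rV[R]_d),
    physical yp -> physical ym -> dot n n = 1 ->
    `|dot (vel yp) n| + Num.sqrt (sound2 yp) <= lam yp ym n /\
    `|dot (vel ym) n| + Num.sqrt (sound2 ym) <= lam yp ym n.

(* w = d(rho e_t)/dy *)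
Definition energy_w y : state :=
  mk_state (vel y) (rho_cv y / (R0 * csum y))
    (\row_i (W i * uspec i (temp y)
             - rho_cv y * pres y / (R0 * csum y ^+ 2)
             - W i / 2 * dot (vel y) (vel y))).

End Physics.

Section Scheme.
Variables (R : realType) (R0 : R) (d ns : nat).
Local Notation state := (state R d ns).

(* The discretization around one element: the element, one neighbor across each
   of its faces (all faces are interior), the polynomial degree, a nodal basis,
   a quadrature rule and a wave speed estimate. *)
Record discretization := Discretization {
  elt : cell R d;
  nbr : face elt -> cell R d;
  deg : nat;
  nb : nat;
  phi : 'I_nb -> mpoly d R;
  node : 'I_nb -> 'rV[R]_d;
  nq : nat;
  xq : 'I_nq -> 'rV[R]_d;
  wq : 'rV[R]_nq;
  lam : state -> state -> 'rV[R]_d -> R }.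

Arguments phi : clear implicits.
Arguments node : clear implicits.
Arguments xq : clear implicits.

Implicit Type D : discretization.

Definition conforming D : Prop :=
  [/\ wf_cell (elt D),
      forall f : face (elt D), wf_cell (nbr f),
      forall f : face (elt D), exists g : face (nbr f),
        [/\ nrm g = - nrm f, off g = - off f & facet g = facet f] &
      forall f g : face (elt D), f != g ->
        open_pts (nbr f) `&` open_pts (nbr g) = set0].

Definition nodal_basis D : Prop :=
  [/\ forall j, deg_le (deg D) (phi D j),
      forall q, deg_le (deg D) q ->
        exists c : 'I_(nb D) -> R, q = \sum_j c j *: phi D j,
      forall j, pts (elt D) (node D j) &
      forall i j, ev (phi D j) (node D i) = (i == j)%:R].

(* Exactness in degree 2p makes the quadrature-based projection below a
   projection onto P_p, its Gram matrix being the exact mass matrix. *)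
Definition quadrature D : Prop :=
  [/\ forall q, pts (elt D) (xq D q),
      forall q, 0 < wq D 0 q &
      forall g, deg_le (2 * deg D) g ->
        \sum_q wq D 0 q * ev g (xq D q) = cell_int (elt D) (ev g)].

Definition wf_discretization (X : mixture R ns) D : Prop :=
  [/\ conforming D, nodal_basis D, quadrature D &
      wave_speed_estimate R0 X (lam D)].

Variables (X : mixture R ns) (D : discretization).
Local Notation K := (elt D).
Local Notation m := (d + 1 + ns)%N.

(* Row j of Y is the j-th coefficient vector of the solution on the element;
   Z f a is the a-th component of the solution on the neighbor across f. *)
Variables (Y : 'M[R]_(nb D, m)) (Z : face K -> 'I_m -> mpoly d R).

Definition expand (A : 'M[R]_(nb D, m)) (a : 'I_m) : mpoly d R :=
  \sum_j A j a *: phi D j.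

Definition eval_state (q : 'I_m -> mpoly d R) (x : 'rV[R]_d) : state :=
  \row_a ev (q a) x.

Definition y_in (x : 'rV[R]_d) : state := eval_state (expand Y) x.
Definition y_out (f : face K) (x : 'rV[R]_d) : state := eval_state (Z f) x.
Definition dy_in (x : 'rV[R]_d) (k : 'I_d) : state :=
  \row_a ev (mderiv k (expand Y a)) x.

Definition everywhere (Q : state -> Prop) : Prop :=
  (forall x, pts K x -> Q (y_in x)) /\
  (forall f x, pts (nbr f) x -> Q (y_out f x)).

Definition mass : 'M[R]_(nb D) :=
  \matrix_(i, j) cell_int K (fun x => ev (phi D i) x * ev (phi D j) x).

Definition residual (k : 'I_(nb D)) : state :=
  boundary_intv (fun (f : face K) x =>
    ev (phi D k) x *: num_flux X (lam D) (y_in x) (y_out f x) (nrm f))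
  - cell_intv K (fun x => flux_n X (y_in x) (grad (phi D k) x))
  + boundary_intv (fun (f : face K) x =>
      ev (phi D k) x *: D_term R0 X (y_in x) (y_out f x) (nrm f))
  + cell_intv K (fun x =>
      ev (phi D k) x *: B_grad R0 X (y_in x) (dy_in x)).

Definition Vq : 'M[R]_(nq D, nb D) := \matrix_(i, j) ev (phi D j) (xq D i).

Definition what : 'M[R]_(nb D, m) :=
  invmx mass *m Vq^T *m diag_mx (wq D) *m
  \matrix_(q < nq D) energy_w R0 X (row q (Vq *m Y)).

Definition wbar : state := (nb D)%:R^-1 *: \sum_k row k what.

Definition alpha_den : R :=
  \sum_k dot (row k what - wbar) (row k what - wbar).

Definition alpha : R :=
  (boundary_int (fun (f : face K) x =>
     num_energy_flux R0 X (lam D) (y_in x) (y_out f x) (nrm f))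
   - \sum_k dot (row k what) (residual k)) / alpha_den.

Definition correction (k : 'I_(nb D)) : state := alpha *: (row k what - wbar).

(* dY is the value of d Y / dt prescribed by the scheme in the state (Y, Z). *)
Definition semi_discretization (dY : 'M[R]_(nb D, m)) : Prop :=
  forall k, \sum_j mass k j *: row j dY + residual k + correction k = 0.

(* Physical state in P_p on the element and its neighbors, for which alpha is
   well defined. *)
Definition admissible : Prop :=
  [/\ forall f a, deg_le (deg D) (Z f a),
      everywhere (physical R0 X) & alpha_den != 0].

Definition dt_state (dY : 'M[R]_(nb D, m)) (x : 'rV[R]_d) : state :=
  eval_state (expand dY) x.

(* d_t v = (1 / rho) d_t (rho v) - (v / rho) d_t rho; rho is linear in y. *)
Definition dt_vel (dY : 'M[R]_(nb D, m)) (x : 'rV[R]_d) : 'rV[R]_d :=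
  (rho X (y_in x))^-1 *: mom (dt_state dY x)
  - (rho X (dt_state dY x) / rho X (y_in x)) *: vel X (y_in x).

Definition equilibrium : Prop :=
  exists (P0 : R) (v0 : 'rV[R]_d),
    everywhere (fun y => pres y = P0 /\ vel X y = v0).

Definition zero_concentration (i : 'I_ns) : Prop :=
  everywhere (fun y => conc y 0 i = 0).

End Scheme.

Arguments phi {R d ns} D j : rename.
Arguments node {R d ns} D j : rename.
Arguments xq {R d ns} D q : rename.

Section Properties.
Variables (R : realType) (R0 : R) (d ns : nat).

Definition velocity_equilibrium_preserving : Prop :=
  forall (X : mixture R ns) (D : discretization R d ns)
    (Y : 'M[R]_(nb D, d + 1 + ns))
    (Z : face (elt D) -> 'I_(d + 1 + ns) -> mpoly d R)
    (dY : 'M[R]_(nb D, d + 1 + ns)),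
    wf_mixture X -> wf_discretization R0 X D ->
    admissible R0 X Y Z -> semi_discretization R0 X Y Z dY ->
    equilibrium X Y Z ->
    forall x, pts (elt D) x -> dt_vel X Y dY x = 0.

Definition pressure_equilibrium_preserving : Prop :=
  forall (X : mixture R ns) (D : discretization R d ns)
    (Y : 'M[R]_(nb D, d + 1 + ns))
    (Z : face (elt D) -> 'I_(d + 1 + ns) -> mpoly d R)
    (dY : 'M[R]_(nb D, d + 1 + ns)),
    wf_mixture X -> wf_discretization R0 X D ->
    admissible R0 X Y Z -> semi_discretization R0 X Y Z dY ->
    equilibrium X Y Z ->
    forall x, pts (elt D) x -> pres (dt_state dY x) = 0.

Definition zero_concentration_preserving : Prop :=
  forall (X : mixture R ns) (D : discretization R d ns)
    (Y : 'M[R]_(nb D, d + 1 + ns))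
    (Z : face (elt D) -> 'I_(d + 1 + ns) -> mpoly d R)
    (dY : 'M[R]_(nb D, d + 1 + ns)),
    wf_mixture X -> wf_discretization R0 X D ->
    admissible R0 X Y Z -> semi_discretization R0 X Y Z dY ->
    forall i : 'I_ns, zero_concentration Y Z i ->
    forall x, pts (elt D) x -> conc (dt_state dY x) 0 i = 0.

End Properties.

(* Main.v *)
Require Import Defs.
From HB Require Import structures.
From mathcomp Require Import all_boot all_order all_algebra.
From mathcomp Require Import all_classical all_reals all_analysis.
From mathcomp Require Import -(notations) mpoly.
From mathcomp Require Import ring lra.
Set Implicit Arguments.
Unset Strict Implicit.
Unset Printing Implicit Defensive.
Import Order.TTheory GRing.Theory Num.Theory.
Local Open Scope ring_scope.

(** The counterexamples compare two instances of the scheme that share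
    everything except the wave speed estimate, which may be any sufficiently
    large quantity: the second estimate is the first one plus 1.  Subtracting
    the two semi-discretizations removes the volume terms, the path terms D and
    the central part of the fluxes; only the dissipation of the face jumps is
    left, and the denominator of alpha and the projection of w = d(rho e_t)/dy
    are the same in both.  So no integral of a non-polynomial function has to be
    computed, nor even shown to exist.

    The setting is the cube [-1, 1]^d with p = 1 and the tensor two-point Gauss
    rule.  All species have molar mass 1 and molar internal energy T^2.  The
    state has velocity e_0, pressure R0, and a single species present, with
    concentration C = 4 + x_0, hence T = 1 / C.  The neighbors continue this
    state, except the one across the face x_0 = 1, where C = 1 instead of 5: the
    face jump is that of an equilibrium state, it has no pressure component, no
    component along absent species, and it carries the velocity e_0.

    At the Gauss points x_0^2 = 1 / 3, so that 1 / C and 1 / C^2 are affine in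
    x_0 there.  The projection of w is therefore known
    exactly (ramp_what): it is w_mean + x_0 w_slope.  With it the change of the
    numerator of alpha is a nonzero multiple of energy_defect, the amount by
    which the jump of rho e_t differs from the projected w applied to the jump
    of y (alpha_shift, energy_defect_neq0).

    Let l be a linear form on states that vanishes on the jump but not on
    w_slope.  If l(dy/dt) were zero at the nodes for both estimates, the
    difference of the two balances would say that the change of alpha times
    l(w_slope) is zero, which is false (ramp_drift).  The three claims follow
    with l the pressure, the first momentum minus the density (whose
    rate of change is rho d_t v_0 at velocity e_0), and the concentration of an absent species. *)

(** * Iterated integrals of sums of products *)

Section IteratedIntegral.
Import numFieldNormedType.Exports.
Variable R : realType.
Local Notation mu := (@lebesgue_measure R).

Lemma integrable_lincomb (I : Type) (r : seq I) (c : I -> R) (h : I -> R -> R) :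
  (forall k, mu.-integrable setT (EFin \o h k)) ->
  mu.-integrable setT (EFin \o (fun t => \sum_(k <- r) c k * h k t)) /\
  \int[mu]_t (\sum_(k <- r) c k * h k t) = \sum_(k <- r) c k * \int[mu]_t h k t.
Proof.
move=> hh; elim: r => [|k r [IHi IHe]].
  have -> : (fun t => \sum_(k <- [::]) c k * h k t) = cst 0.
    by apply/funext => t; rewrite big_nil.
  rewrite big_nil; split; last by rewrite Rintegral_cst ?mul0r.
  exact: integrable0.
have hk : mu.-integrable setT (EFin \o (fun t => c k * h k t)).
  exact: (integrableZl measurableT (c k) (hh k)).
have -> : (fun t => \sum_(k <- k :: r) c k * h k t) =
    (fun t => c k * h k t + \sum_(k <- r) c k * h k t).
  by apply/funext => t; rewrite big_cons.
rewrite big_cons; split; last by rewrite RintegralD // IHe RintegralZl.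
exact: (integrableD measurableT hk IHi).
Qed.

Lemma row_mx_head n (t : R) (v : 'rV[R]_n) :
  (row_mx (t%:M : 'rV[R]_1) v : 'rV[R]_n.+1) 0 ord0 = t.
Proof.
rewrite mxE; case: splitP => [i _|i /= /esym/eqP]; last by rewrite addn_eq0.
by rewrite ord1 mxE eqxx mulr1n.
Qed.

Lemma row_mx_tail n (t : R) (v : 'rV[R]_n) i :
  (row_mx (t%:M : 'rV[R]_1) v : 'rV[R]_n.+1) 0 (lift ord0 i) = v 0 i.
Proof.
rewrite mxE; case: splitP => [[[] //= _]|j /= [ij]].
by congr (v 0 _); apply: val_inj.
Qed.

(** The integral is iterated by definition, so for finite sums of products the
    linearity of the one-dimensional integral is enough, one coordinate at a
    time. *)
Lemma int_Rn_sum_prod n (I : Type) (r : seq I) (c : I -> R)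
    (g : I -> 'I_n -> R -> R) :
  (forall k i, mu.-integrable setT (EFin \o g k i)) ->
  int_Rn (fun x : 'rV[R]_n => \sum_(k <- r) c k * \prod_i g k i (x 0 i)) =
  \sum_(k <- r) c k * \prod_i \int[mu]_t g k i t.
Proof.
elim: n c g => [|n IHn] c g hg /=.
  by apply: eq_bigr => k _; rewrite !big_ord0.
transitivity (\int[mu]_t (\sum_(k <- r)
    (c k * \prod_(i < n) \int[mu]_t g k (lift ord0 i) t) * g k ord0 t)).
  congr Rintegral; apply/funext => t.
  transitivity (\sum_(k <- r) (c k * g k ord0 t) *
      \prod_(i < n) \int[mu]_t g k (lift ord0 i) t); last first.
    by apply: eq_bigr => k _; rewrite mulrAC.
  rewrite -IHn //; congr (int_Rn _); apply/funext => v.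
  apply: eq_bigr => k _; rewrite big_ord_recl row_mx_head mulrA.
  by congr (_ * _); apply: eq_bigr => i _; rewrite row_mx_tail.
rewrite (integrable_lincomb r _ (fun k => hg k ord0)).2.
by apply: eq_bigr => k _; rewrite big_ord_recl mulrA mulrAC -mulrA.
Qed.

Lemma int_poly_itv (p P : {poly R}) (a b : R) : P^`() = p -> a <= b ->
  \int[mu]_(t in `[a, b]) p.[t] = P.[b] - P.[a].
Proof.
move=> dP; rewrite le_eqVlt => /predU1P[->|ab].
  by rewrite set_itv1 Rintegral_set1 subrr.
rewrite /Rintegral (@continuous_FTC2 _ _ (horner P)) //.
- by apply: continuous_subspaceT => x; exact: continuous_horner.
- split.
  + by move=> x _; exact: derivable_horner.
  + exact/cvg_at_right_filter/continuous_horner.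
  + exact/cvg_at_left_filter/continuous_horner.
- by move=> x _; rewrite -derivE dP.
Qed.

Lemma oriented_int_poly (p P : {poly R}) (a b : R) : P^`() = p ->
  oriented_int a b (fun t => p.[t]) = P.[b] - P.[a].
Proof.
move=> dP; rewrite /oriented_int; case: leP => ab.
  exact: int_poly_itv.
by rewrite (int_poly_itv dP) ?ltW // opprB.
Qed.

Lemma integrable_itv_poly (p : {poly R}) (a b : R) :
  mu.-integrable setT (EFin \o (fun t => \1_(`[a, b]%classic) t * p.[t])).
Proof.
have : mu.-integrable `[a, b]%classic (EFin \o (fun t => p.[t])).
  apply: continuous_compact_integrable; first exact: segment_compact.
  by apply: continuous_subspaceT => x; exact: continuous_horner.
rewrite integrable_mkcond; last exact: measurable_itv.
apply: eq_integrable => // t _.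
rewrite /= patchE indicE.
by case: ifP => _ /=; rewrite ?mul1r ?mul0r.
Qed.

Lemma int_indic_poly (p P : {poly R}) (a b : R) : P^`() = p -> a <= b ->
  \int[mu]_t (\1_(`[a, b]%classic) t * p.[t]) = P.[b] - P.[a].
Proof.
move=> dP ab; rewrite -(int_poly_itv dP ab) [RHS]Rintegral_mkcond.
apply: eq_Rintegral => t _; rewrite /patch indicE.
by case: ifP => _ /=; rewrite ?mul1r ?mul0r.
Qed.

End IteratedIntegral.

(** * The tensor Gauss rule on the cube *)

Section Gauss.
Variable R : realType.
Local Notation mu := (@lebesgue_measure R).

Definition gauss_abs : R := Num.sqrt 3^-1.

Lemma gauss_abs2 : gauss_abs ^+ 2 = 3^-1.
Proof. by rewrite sqr_sqrtr // invr_ge0. Qed.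

Lemma gauss_abs_le1 : `|gauss_abs| <= 1.
Proof.
rewrite -(@ler_pXn2r _ 2) ?nnegrE // -normrX gauss_abs2 expr1n ger0_norm; lra.
Qed.

Definition gauss_pt n (e : {ffun 'I_n -> bool}) : 'rV[R]_n :=
  \row_i ((-1) ^+ e i * gauss_abs).

Lemma gauss_pt_sqr n e (i : 'I_n) : gauss_pt e 0 i ^+ 2 = 3^-1.
Proof. by rewrite mxE exprMn sqrr_sign mul1r gauss_abs2. Qed.

(** The two-point rule is exact up to degree 3; degree 2 is what the products
    of two affine functions need. *)
Lemma gauss_1d (k : nat) : (k <= 2)%N ->
  \int[mu]_t (\1_(`[(-1), 1]%classic) t * t ^+ k) =
  \sum_(b : bool) ((-1) ^+ b * gauss_abs) ^+ k.
Proof.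
move=> k2; pose q : {poly R} := 'X^k.
transitivity (\int[mu]_t (\1_(`[(-1), 1]%classic) t * q.[t])).
  by apply: eq_Rintegral => t _; rewrite /q hornerXn.
have dP : ((k.+1%:R^-1 *: 'X^(k.+1))^`() : {poly R}) = q.
  rewrite derivZ derivXn /= -scalerMnr scalerMnl -mulr_natr.
  by rewrite mulVf ?scale1r ?pnatr_eq0.
have le11 : (-1 : R) <= 1 by lra.
rewrite (int_indic_poly dP le11).
rewrite !hornerZ !hornerXn big_bool /=.
have := gauss_abs2; case: k k2 @q {dP} => [|[|[|//]]] _ _.
all: rewrite ?expr0 ?expr1 ?expr2 => h; try lra; try nra.
Qed.

Definition cube_indic n (x : 'rV[R]_n) : R :=
  \prod_i \1_(`[(-1), 1]%classic) (x 0 i).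

(** Exactness passes from one to n dimensions monomial by monomial: the
    exponents of a monomial are at most its degree, and a sum over the sign
    patterns of a product is the product of the sums. *)
Lemma gauss_cube n (g : mpoly n R) : (mmeasure mdeg g <= 3)%N ->
  int_Rn (fun x => cube_indic x * ev g x) =
  \sum_(e : {ffun 'I_n -> bool}) ev g (gauss_pt e).
Proof.
move=> g3.
transitivity (int_Rn (fun x : 'rV[R]_n => \sum_(m <- msupp g)
    mcoeff m g * \prod_i (\1_(`[(-1), 1]%classic) (x 0 i) * x 0 i ^+ m i))).
  congr (int_Rn _); apply/funext => x; rewrite /ev mevalE mulr_sumr.
  by apply: eq_bigr => m _; rewrite big_split /= mulrCA.
rewrite (int_Rn_sum_prod (msupp g) (fun m => mcoeff m g)
  (g := fun m i t => \1_(`[(-1), 1]%classic) t * t ^+ m i)); last first.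
  move=> m i; have := integrable_itv_poly ('X^(m i)) (-1) (1 : R).
  by apply: eq_integrable => // t _ /=; rewrite hornerXn.
rewrite (eq_bigr (fun e => \sum_(m <- msupp g)
    mcoeff m g * \prod_i gauss_pt e 0 i ^+ m i)); last first.
  by move=> e _; rewrite /ev mevalE.
rewrite exchange_big /=; apply: eq_big_seq => m mg.
rewrite -mulr_sumr; congr (_ * _).
rewrite (eq_bigr (fun i => \sum_(b : bool) ((-1) ^+ b * gauss_abs) ^+ m i)).
  rewrite bigA_distr_bigA; apply: eq_bigr => e _.
  by apply: eq_bigr => i _; rewrite mxE.
move=> i _; apply: gauss_1d; rewrite -ltnS.
apply: leq_trans g3; apply: leq_ltn_trans (msize_mdeg_lt mg).
by rewrite mdegE (bigD1 i) //= leq_addr.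
Qed.

End Gauss.

(** * Cubes and their neighbors *)

Section Dot.
Variables (R : realType) (n : nat).
Implicit Types u v w : 'rV[R]_n.

Lemma dotDr u v w : dot u (v + w) = dot u v + dot u w.
Proof.
by rewrite /dot -big_split /=; apply: eq_bigr => i _; rewrite mxE mulrDr.
Qed.

Lemma dotZr a u v : dot u (a *: v) = a * dot u v.
Proof.
by rewrite /dot mulr_sumr; apply: eq_bigr => i _; rewrite mxE mulrCA.
Qed.

Lemma dotC u v : dot u v = dot v u.
Proof. by apply: eq_bigr => i _; rewrite mulrC. Qed.

Lemma dot0 u : dot u 0 = 0.
Proof. by rewrite /dot big1 // => i _; rewrite mxE mulr0. Qed.

Lemma dotNr u v : dot u (- v) = - dot u v.
Proof. by rewrite -scaleN1r dotZr mulN1r. Qed.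

Lemma dot_delta v i : dot (delta_mx 0 i) v = v 0 i.
Proof.
rewrite /dot (bigD1 i) //= big1 ?addr0 => [|j ji]; rewrite mxE.
  by rewrite !eqxx mul1r.
by rewrite (negbTE ji) andbF mul0r.
Qed.

Lemma dot_eq0 v : (dot v v == 0) = (v == 0).
Proof.
apply/eqP/eqP => [v0|->]; last exact: dot0.
apply/rowP => i; rewrite mxE; move/eqP: v0.
rewrite psumr_eq0 => [/allP/(_ i)|j _].
  by rewrite mem_index_enum mulf_eq0 orbb => /(_ isT)/eqP.
by rewrite -expr2 sqr_ge0.
Qed.

End Dot.

Section Cube.
Variables (R : realType) (n : nat).
Implicit Types (f g : 'I_n * bool) (x c : 'rV[R]_n).

(** The face (i, false) is x_i = c_i + 1, and (i, true) is x_i = c_i - 1. *)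
Definition face_nrm f : 'rV[R]_n := (-1) ^+ f.2 *: delta_mx 0 f.1.

Definition cube c : cell R n := Cell face_nrm (fun f => 1 + dot (face_nrm f) c).

Lemma dot_face f x : dot (face_nrm f) x = (-1) ^+ f.2 * x 0 f.1.
Proof. by rewrite dotC dotZr dotC dot_delta. Qed.

Lemma face_nrm_opp i b : face_nrm (i, ~~ b) = - face_nrm (i, b).
Proof. by rewrite /face_nrm /= signrN scaleNr. Qed.

Lemma dot_face_self f : dot (face_nrm f) (face_nrm f) = 1.
Proof. by rewrite dot_face !mxE !eqxx mulr1 -expr2 sqrr_sign. Qed.

Lemma dot_face_le0 f g : g != f -> dot (face_nrm g) (face_nrm f) <= 0.
Proof.
case: f g => [i b] [j b']; rewrite xpair_eqE negb_and dot_face !mxE /=.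
have [_|_] := eqVneq j i; last by rewrite !mulr0.
rewrite /= mulr1; case: b b' => [] [] //= _.
all: by rewrite ?expr0 ?expr1 ?mulr1 ?mul1r oppr_le0.
Qed.

Lemma pts_cubeP c x : pts (cube c) x <-> forall i, `|x 0 i - c 0 i| <= 1.
Proof.
split=> [xc i|xc [i b]]; last first.
  have := xc i; rewrite ler_norml /= !dot_face /=.
  by case: b; rewrite ?expr0 ?expr1 => /andP[]; lra.
have := xc (i, true); have := xc (i, false).
rewrite /= !dot_face /= ?expr0 ?expr1 ler_norml => h1 h2.
by apply/andP; split; lra.
Qed.

Lemma wf_cube c : wf_cell (cube c).
Proof.
split.
- by exists c => f; rewrite /= ltrDr.
- exists (\sum_i (1 + `|c 0 i|)) => x /pts_cubeP xc i.
  rewrite (bigD1 i) //= -[leLHS]addr0; apply: lerD.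
    rewrite -[x 0 i](subrK (c 0 i)); apply: le_trans (ler_normD _ _) _.
    by rewrite lerD2r.
  by apply: sumr_ge0 => j _; rewrite addr_ge0.
- exact: dot_face_self.
- move=> f; exists (c + face_nrm f); rewrite /= ?dotDr.
    by rewrite dot_face_self addrC.
  move=> g gf; rewrite dotDr [ltRHS]addrC ltrD2l.
  by apply: le_lt_trans (dot_face_le0 gf) _.
Qed.

(** The neighbor across a face is the reflection of the cube in that face; it
    meets it with the opposite normal. *)
Lemma cube_facet_nbr f :
  let g : face (cube (2 *: face_nrm f)) := (f.1, ~~ f.2) in
  let f' : face (cube 0) := f in
  [/\ nrm g = - nrm f', off g = - off f' & facet g = facet f'].
Proof.
case: f => i b g f'; split.
- exact: face_nrm_opp.
- rewrite /= face_nrm_opp dot0 dotC dotNr dotC dotZr dot_face_self; lra.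
apply/seteqP; rewrite {}/g {}/f'.
split=> x [/pts_cubeP xc]; rewrite /= !dot_face /= => xi.
  split.
    apply/pts_cubeP => j; have := xc j; have := xc i; move: xi.
    have [->|ji] := eqVneq j i; rewrite !mxE ?eqxx /= ?(negbTE ji);
      rewrite ?mulr0 ?mulr1 ?addr0 //.
    case: b {xc}; rewrite /= ?expr0 ?expr1 !ler_norml => h /andP[h1 h2] _;
      by apply/andP; split; lra.
  move: xi; rewrite !mxE !eqxx /=.
  by rewrite !dot_face /= ?mxE; case: b {xc}; rewrite /= ?expr0 ?expr1; lra.
split.
  apply/pts_cubeP => j; have := xc j; have := xc i; move: xi.
  have [->|ji] := eqVneq j i; rewrite !mxE ?eqxx /= ?(negbTE ji);
    rewrite ?mulr0 ?mulr1 ?addr0 //.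
  case: b {xc}; rewrite /= ?expr0 ?expr1 !ler_norml => h /andP[h1 h2] _;
    by apply/andP; split; lra.
rewrite /= !dot_face !mxE !eqxx /=.
by move: xi; rewrite mxE; case: b {xc}; rewrite /= ?expr0 ?expr1; lra.
Qed.

(** The face f separates its neighbor from all the others: the normal of another
    face never points towards f. *)
Lemma cube_nbr_disjoint f g : f != g ->
  (open_pts (cube (2 *: face_nrm f)) `&`
   open_pts (cube (2 *: face_nrm g)))%classic = set0.
Proof.
move=> fg; apply/seteqP; split=> // x [xf xg].
have [g'E g'o _] := cube_facet_nbr f.
have := xf (f.1, ~~ f.2); rewrite g'o g'E dotC dotNr dotC ltrN2 => xf1.
have := xg f; have := dot_face_le0 fg.
by move: xf1; rewrite /= !dotZr dot0; lra.
Qed.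

End Cube.

(** * The nodal basis of the affine functions *)

Section Affine.
Variables (R : realType) (n : nat).

Definition mvar (i : 'I_n) : mpoly n R := mpolyX R (mnm1 i).

Lemma evD (p q : mpoly n R) x : ev (p + q) x = ev p x + ev q x.
Proof. exact: mevalD. Qed.

Lemma evZ a (p : mpoly n R) x : ev (a *: p) x = a * ev p x.
Proof. exact: mevalZ. Qed.

Lemma evC a x : ev (mpolyC n a : mpoly n R) x = a.
Proof. exact: mevalC. Qed.

Lemma ev_var i x : ev (mvar i) x = x 0 i.
Proof. exact: mevalXU. Qed.

Lemma ev_sum (I : Type) (r : seq I) (P : pred I) (p : I -> mpoly n R) x :
  ev (\sum_(i <- r | P i) p i) x = \sum_(i <- r | P i) ev (p i) x.
Proof. exact: raddf_sum. Qed.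

Definition affine (b : R) (c : 'rV[R]_n) : mpoly n R :=
  mpolyC n b + \sum_i c 0 i *: mvar i.

Lemma ev_affine b c x : ev (affine b c) x = b + dot c x.
Proof.
rewrite /affine evD evC ev_sum; congr (_ + _).
by apply: eq_bigr => i _; rewrite evZ ev_var.
Qed.

Lemma affine_deg b c : deg_le 1 (affine b c).
Proof.
apply: leq_trans (msizeD_le _ _) _; rewrite geq_max msizeC; apply/andP; split.
  by case: eqP.
apply: leq_trans (msize_sum _ _ _) _; apply/bigmax_leqP_seq => i _ _.
by apply: leq_trans (msizeZ_le _ _) _; rewrite /mvar msizeX mdeg1.
Qed.

Lemma affine_surj q : deg_le 1 q ->
  q = affine (mcoeff (@mnm0 n) q) (\row_i mcoeff (mnm1 i) q).
Proof.
move=> q1; apply/mpolyP => m; rewrite /affine mcoeffD mcoeffC raddf_sum /=.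
under eq_bigr do rewrite mxE mcoeffZ mcoeffX.
have [/eqP|m0] := eqVneq (mdeg m) 0%N.
  rewrite mdeg_eq0 => /eqP ->; rewrite eqxx mulr1 big1 ?addr0 // => i _.
  by rewrite mnm1_eq0 mulr0.
have [/eqP/mdeg1P[i /eqP ->]|m1] := eqVneq (mdeg m) 1%N.
  rewrite mnm1_eq0 mulr0 add0r (bigD1 i) //= eqxx mulr1 big1 ?addr0 // => j ji.
  by rewrite eq_mnm1 (negbTE ji) mulr0.
rewrite -mdeg_eq0 (negbTE m0) mulr0 add0r big1 => [|i _].
  apply/memN_msupp_eq0/msize_mdeg_ge; apply: leq_trans q1 _.
  by move: m0 m1; case: (mdeg m) => [|[|]].
case: eqP => [mi|_]; last by rewrite mulr0.
by move: m1; rewrite -mi mdeg1.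
Qed.

(** The nodes are the origin (index 0) and the ends of the unit vectors; the
    basis consists of the barycentric coordinates 1 - sum_i x_i and x_i. *)
Definition p1_basis (j : 'I_n.+1) : mpoly n R :=
  if unlift ord0 j is Some i then affine 0 (delta_mx 0 i)
  else affine 1 (const_mx (-1)).

Definition p1_node (j : 'I_n.+1) : 'rV[R]_n :=
  if unlift ord0 j is Some i then delta_mx 0 i else 0.

Lemma p1_basis_interp (f : 'I_n.+1 -> R) x :
  \sum_j f j * ev (p1_basis j) x =
  f ord0 + \sum_i (f (lift ord0 i) - f ord0) * x 0 i.
Proof.
rewrite big_ord_recl /p1_basis unlift_none ev_affine mulrDr mulr1 -addrA.
congr (_ + _); rewrite /dot mulr_sumr -big_split /=; apply: eq_bigr => i _.
by rewrite liftK ev_affine add0r dot_delta mxE; ring.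
Qed.

(** Affine functions are interpolated exactly. *)
Lemma p1_basis_affine b c x :
  \sum_j (b + dot c (p1_node j)) * ev (p1_basis j) x = b + dot c x.
Proof.
rewrite p1_basis_interp /p1_node unlift_none.
have -> : dot c 0 = 0 by rewrite /dot big1 // => i _; rewrite mxE mulr0.
rewrite addr0; congr (_ + _); apply: eq_bigr => i _.
by rewrite liftK dotC dot_delta addrC addKr.
Qed.

Lemma p1_basis_node i j : ev (p1_basis j) (p1_node i) = (i == j)%:R.
Proof.
rewrite /p1_basis /p1_node.
case: (unliftP ord0 i) => [i' ->|->]; case: (unliftP ord0 j) => [j' ->|->] /=;
  rewrite ev_affine ?dot_delta ?(inj_eq lift_inj) ?mxE ?eqxx ?andTb ?add0r.
- by rewrite eq_sym.
- by rewrite dotC dot_delta mxE subrr.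
- by [].
- by rewrite /dot big1 ?addr0 // => k _; rewrite !mxE mulr0.
Qed.

Lemma p1_basis_deg j : deg_le 1 (p1_basis j).
Proof. by rewrite /p1_basis; case: unlift => [i|]; exact: affine_deg. Qed.

Lemma affine_delta i : affine 0 (delta_mx 0 i) = mvar i.
Proof.
rewrite /affine mpolyC0 add0r (bigD1 i) //= mxE !eqxx scale1r big1 ?addr0 //.
by move=> k ki; rewrite mxE (negbTE ki) andbF scale0r.
Qed.

Lemma affine_p1E b c :
  affine b c = \sum_j (b + dot c (p1_node j)) *: p1_basis j.
Proof.
rewrite big_ord_recl /p1_basis /p1_node unlift_none.
have -> : dot c 0 = 0 by rewrite /dot big1 // => i _; rewrite mxE mulr0.
rewrite addr0 {2}/affine scalerDr scaler_sumr -addrA mpolyC1 alg_mpolyC.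
congr (_ + _); rewrite -big_split /=; apply: eq_bigr => i _.
rewrite liftK dotC dot_delta affine_delta mxE scalerA -scalerDl.
by congr (_ *: _); ring.
Qed.

Lemma p1_basis_mul_deg i j : deg_le 2 (p1_basis i * p1_basis j).
Proof.
have d1 := p1_basis_deg i; have d2 := p1_basis_deg j; rewrite /deg_le.
have [->|p0] := eqVneq (p1_basis i) 0; first by rewrite mul0r mmeasure0.
have [->|q0] := eqVneq (p1_basis j) 0; first by rewrite mulr0 mmeasure0.
rewrite msizeM // -ltnS prednK.
  move: d1 d2; rewrite /deg_le; set a := mmeasure _ _; set b := mmeasure _ _.
  by case: a b => [|[|[|//]]] [|[|[|//]]].
by rewrite addn_gt0 lt0n msize_poly_eq0 p0.
Qed.

End Affine.

(** * Integrals over the cube and its faces *)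

Section CubeIntegrals.
Variables (R : realType).

Lemma cube_indicE n (x : 'rV[R]_n) :
  cube_indic x = [forall i, `|x 0 i| <= 1]%:R.
Proof.
rewrite /cube_indic; case: forallP => [x1|/forallP].
  by apply: big1 => i _; rewrite indicE mem_set //= in_itv /= -ler_norml.
rewrite negb_forall => /existsP[i xi].
rewrite (bigD1 i) //= indicE memNset ?mul0r //.
by rewrite /= in_itv /= -ler_norml; exact/negP.
Qed.

Lemma indic_pts_cube n (x : 'rV[R]_n) :
  \1_(pts (cube 0)) x = cube_indic x.
Proof.
rewrite cube_indicE indicE; congr (_ : bool)%:R.
apply/idP/forallP => [/set_mem/pts_cubeP x1 i|x1].
  by have := x1 i; rewrite mxE subr0.
by apply/mem_set/pts_cubeP => i; rewrite mxE subr0.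
Qed.

Lemma cell_int_cube n (g : mpoly n R) : deg_le 2 g ->
  cell_int (cube 0) (ev g) = \sum_(e : {ffun 'I_n -> bool}) ev g (gauss_pt R e).
Proof.
move=> g2; rewrite -gauss_cube // /cell_int; congr (int_Rn _).
by apply/funext => x; rewrite indic_pts_cube.
Qed.

Lemma gauss_pt_sum n (i : 'I_n) :
  \sum_(e : {ffun 'I_n -> bool}) gauss_pt R e 0 i = 0.
Proof.
pose F k (b : bool) : R := if k == i then (-1) ^+ b * gauss_abs R else 1.
rewrite (eq_bigr (fun e : {ffun 'I_n -> bool} => \prod_k F k (e k))).
  rewrite -bigA_distr_bigA (bigD1 i) //= big_bool /F eqxx /= expr1 expr0.
  by rewrite mulN1r mul1r addNr mul0r.
by move=> e _; rewrite mxE /F -big_mkcond big_pred1_eq.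
Qed.

(** The integral sees only the value at the center, the cube being symmetric. *)
Lemma int_cube_affine n (b : R) (c : 'rV[R]_n) :
  int_Rn (fun x => cube_indic x * (b + dot c x)) = b * 2 ^+ n.
Proof.
transitivity (int_Rn (fun x => cube_indic x * ev (affine b c) x)).
  by congr (int_Rn _); apply/funext => x; rewrite ev_affine.
rewrite gauss_cube; last exact: leq_trans (affine_deg b c) _.
under eq_bigr do rewrite ev_affine.
rewrite big_split /= [X in _ + X]exchange_big [X in _ + X]big1 => [|i _].
  rewrite addr0 sumr_const card_ffun card_bool card_ord.
  by rewrite -[LHS]mulr_natr natrX.
by rewrite -mulr_sumr gauss_pt_sum mulr0.
Qed.

(** The face x_0 = 1, the only one across which the test state jumps. *)
Definition jump_face n : 'I_n.+1 * bool := (ord0, false).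

Definition jump_face_pt n (v : 'rV[R]_n) : 'rV[R]_n.+1 :=
  \row_j (if unlift ord0 j is Some j' then v 0 j' else 1).

Lemma face_nrm_jump_face n : face_nrm R (jump_face n) = delta_mx 0 ord0.
Proof. by rewrite /face_nrm expr0 scale1r. Qed.

Lemma facet_int_jump_face n (g : 'rV[R]_n.+1 -> R) :
  facet_int (K := cube 0) (jump_face n) g =
  int_Rn (fun v : 'rV[R]_n => cube_indic v * g (jump_face_pt v)).
Proof.
rewrite /facet_int; case: pickP => [i|/(_ ord0)]; last first.
  by rewrite /= face_nrm_jump_face mxE !eqxx oner_eq0.
rewrite /= face_nrm_jump_face mxE eqxx /=.
have [-> _|_] := eqVneq i ord0; last by rewrite eqxx.
rewrite normr1 divr1; congr (int_Rn _); apply/funext => v.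
have -> : hyperplane_pt (d := n.+1) (delta_mx 0 ord0)
    (1 + @dot R n.+1 (delta_mx 0 ord0) 0) ord0 v = jump_face_pt v.
  apply/rowP => j; rewrite !mxE !eqxx divr1; case: (unlift ord0 j) => // .
  rewrite dot_delta mxE addr0 big1 ?subr0 // => k _.
  by rewrite mxE eqxx /= mul0r.
rewrite indic_pts_cube !cube_indicE; congr (_ %:R * _); congr nat_of_bool.
apply/forallP/forallP => [h k|h k].
  by have := h (lift ord0 k); rewrite mxE liftK.
rewrite mxE; case: (unlift ord0 k) => [j|]; first exact: h.
by rewrite normr1.
Qed.

Lemma facet_int_jump_face_affine n (a b : R) (c : 'rV[R]_n.+1) :
  facet_int (K := cube 0) (jump_face n) (fun x => a * (b + dot c x)) =
  a * (b + c 0 ord0) * 2 ^+ n.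
Proof.
rewrite facet_int_jump_face.
rewrite -(int_cube_affine _ (a *: \row_i c 0 (lift ord0 i))).
congr (int_Rn _); apply/funext => v; congr (_ * _).
rewrite /dot big_ord_recl mxE unlift_none mulr1 !mulrDr mulr_sumr addrA.
congr (_ + _); apply: eq_bigr => i _.
by rewrite !mxE liftK mulrA.
Qed.

(** Facet integrals depend on the integrand on the facet only, whatever its
    integrability. *)
Lemma eq_facet_int d (K : cell R d) (f : face K) (g h : 'rV[R]_d -> R) :
  (forall x, facet f x -> g x = h x) -> facet_int f g = facet_int f h.
Proof.
move=> gh; rewrite /facet_int; case: pickP => // i ni.
congr (_ / _); congr (int_Rn _); apply/funext => v /=.
set x := hyperplane_pt _ _ _ _.
rewrite indicE.
case: (boolP (x \in _)) => [/set_mem xK|_]; last by rewrite !mul0r.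
congr (_ * _); apply: gh; split => //.
rewrite /x /dot (bigD1_ord i) //= mxE unlift_none mulrC divfK //.
by rewrite -[RHS](subrK (\sum_j nrm f 0 (lift i j) * v 0 j)); congr (_ + _);
  apply: eq_bigr => j _; rewrite mxE liftK.
Qed.

End CubeIntegrals.

(** * The mixture and its equilibrium states *)

Section MkState.
Variables (R : realType) (d ns : nat).
Implicit Types (a : 'rV[R]_d) (b : R) (c : 'rV[R]_ns).

Lemma mom_mk a b c : mom (mk_state a b c) = a.
Proof. by rewrite /mom /mk_state !row_mxKl. Qed.

Lemma pres_mk a b c : pres (mk_state a b c) = b.
Proof. by rewrite /pres /mk_state row_mxKl row_mxKr mxE eqxx. Qed.

Lemma conc_mk a b c : conc (mk_state a b c) = c.
Proof. by rewrite /conc /mk_state row_mxKr. Qed.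

Lemma mk_stateD a b c a' b' c' :
  mk_state a b c + mk_state a' b' c' = mk_state (a + a') (b + b') (c + c').
Proof. by rewrite /mk_state !add_row_mx raddfD. Qed.

Lemma mk_stateZ k a b c :
  k *: mk_state a b c = mk_state (k *: a) (k * b) (k *: c).
Proof. by rewrite /mk_state !scale_row_mx scale_scalar_mx. Qed.

Lemma mk_stateB a b c a' b' c' :
  mk_state a b c - mk_state a' b' c' = mk_state (a - a') (b - b') (c - c').
Proof. by rewrite -scaleN1r mk_stateZ mk_stateD !scaleN1r mulN1r. Qed.

Lemma dot_row_mx m n (u u' : 'rV[R]_m) (v v' : 'rV[R]_n) :
  dot (row_mx u v) (row_mx u' v') = dot u u' + dot v v'.
Proof.
rewrite /dot big_split_ord; congr (_ + _); apply: eq_bigr => i _.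
  by rewrite !row_mxEl.
by rewrite !row_mxEr.
Qed.

Lemma dot_mk a b c (y : state R d ns) :
  dot (mk_state a b c) y = dot a (mom y) + b * pres y + dot c (conc y).
Proof.
rewrite -[y in LHS]hsubmxK -[lsubmx y in LHS]hsubmxK !dot_row_mx.
congr (_ + _ + _).
by rewrite /dot big_ord1 mxE eqxx.
Qed.

End MkState.

Section Mixture.
Variables (R : realType) (R0 : R) (n s : nat).
Hypothesis R0_gt0 : 0 < R0.
Let d := n.+1.
Let ns := s.+1.

(** The data are such that the molar internal energy is u_i(T) = T^2
    (uspec_quad_mix).  It must not be affine in T: otherwise w would be constant
    along the state below, and the correction zero. *)
Definition quad_mix : mixture R ns :=
  Mixture (fun _ => 1) (fun _ => R0 + 1) 1 (fun _ => R0%:P + 2 *: 'X).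

Lemma wf_quad_mix : wf_mixture quad_mix.
Proof. by split => [|i]; exact: ltr01. Qed.

Lemma uspec_quad_mix i T : uspec R0 quad_mix i T = T ^+ 2.
Proof.
rewrite /uspec /= (oriented_int_poly (P := R0 *: 'X + 'X^2)).
  by rewrite !hornerE /=; field.
rewrite derivD derivZ derivX derivXn expr1 scaler_nat.
by rewrite -alg_polyC.
Qed.

(** Velocity e_0, pressure R0, and species 0 alone with concentration C. *)
Definition equil_state (C : R) : state R d ns :=
  mk_state (C *: delta_mx 0 ord0) R0 (C *: delta_mx 0 ord0).

Definition equil_dir : state R d ns :=
  mk_state (delta_mx 0 ord0) 0 (delta_mx 0 ord0).

Lemma equil_stateD C t : equil_state (C + t) = equil_state C + t *: equil_dir.
Proof. by rewrite /equil_dir mk_stateZ mk_stateD mulr0 addr0 -!scalerDl. Qed.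

Lemma pres_equil C : pres (equil_state C) = R0.
Proof. exact: pres_mk. Qed.

Lemma sum_conc_equil C (f : R) :
  \sum_i conc (equil_state C) 0 i * f = C * f.
Proof.
rewrite -mulr_suml conc_mk (bigD1 ord0) //= big1 => [|i i0].
  by rewrite !mxE !eqxx mulr1 addr0.
by rewrite !mxE (negbTE i0) andbF mulr0.
Qed.

Lemma rho_quad_mix (y : state R d ns) : rho quad_mix y = csum y.
Proof. by apply: eq_bigr => i _; rewrite mul1r. Qed.

Lemma csum_equil C : csum (equil_state C) = C.
Proof.
rewrite /csum -[RHS]mulr1 -sum_conc_equil.
by apply: eq_bigr => i _; rewrite mulr1.
Qed.

Lemma vel_equil C : C != 0 -> vel quad_mix (equil_state C) = delta_mx 0 ord0.
Proof.
move=> C0; rewrite /vel rho_quad_mix csum_equil mom_mk scalerA.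
by rewrite mulVf // scale1r.
Qed.

Lemma temp_equil C : temp R0 (equil_state C) = C^-1.
Proof.
rewrite /temp pres_equil csum_equil invfM mulrA divff ?mul1r //.
by rewrite gt_eqF.
Qed.

Lemma rho_cv_equil C : C != 0 -> rho_cv R0 quad_mix (equil_state C) = 2.
Proof.
move=> C0; rewrite /rho_cv temp_equil.
under eq_bigr do rewrite /= mul1r.
by rewrite sum_conc_equil !hornerE /=; field.
Qed.

Lemma dot_delta_self m (i : 'I_m) :
  dot (delta_mx 0 i : 'rV[R]_m) (delta_mx 0 i) = 1.
Proof. by rewrite dot_delta mxE !eqxx. Qed.

Lemma rho_et_equil C : C != 0 ->
  rho_et R0 quad_mix (equil_state C) = C^-1 + 2^-1 * C.
Proof.
move=> C0; rewrite /rho_et temp_equil rho_quad_mix csum_equil vel_equil //.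
rewrite dot_delta_self.
under eq_bigr do rewrite mul1r uspec_quad_mix.
by rewrite sum_conc_equil; field.
Qed.

Lemma energy_w_equil C : C != 0 ->
  energy_w R0 quad_mix (equil_state C) =
  mk_state (delta_mx 0 ord0) (2 / (R0 * C)) (const_mx (- C ^- 2 - 2^-1)).
Proof.
move=> C0; rewrite /energy_w vel_equil // rho_cv_equil // csum_equil.
congr mk_state; apply/rowP => i.
rewrite !mxE dot_delta_self uspec_quad_mix temp_equil pres_equil /=; field.
by rewrite C0 gt_eqF.
Qed.

Lemma physical_equil C : 0 < C -> physical R0 quad_mix (equil_state C).
Proof.
move=> C0; split.
- by rewrite rho_quad_mix csum_equil.
- by rewrite pres_equil.
- move=> i; rewrite conc_mk !mxE; apply: mulr_ge0; [exact: ltW|exact: ler0n].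
- by move=> i; rewrite temp_equil /= !hornerE divr1 ltrDl mulr_gt0 // invr_gt0.
Qed.

(** Since (4 + x) (4 - x) = 47 / 3 when x^2 = 1 / 3, at C = 4 + x one has
    1 / C = (12 - 3 x) / 47 and 1 / C^2 = (147 - 72 x) / 2209, both affine in x
    (47^2 = 2209). *)
Definition w_mean : state R d ns :=
  mk_state (delta_mx 0 ord0) (24 / (47 * R0))
    (const_mx (- (147 / 2209) - 2^-1)).

Definition w_slope : state R d ns :=
  mk_state 0 (- (6 / (47 * R0))) (const_mx (72 / 2209)).

Lemma energy_w_affine x : x ^+ 2 = 3^-1 ->
  energy_w R0 quad_mix (equil_state (4 + x)) = w_mean + x *: w_slope.
Proof.
move=> x2; have c0 : 4 + x != 0.
  apply/eqP => x4; have xE : x = - 4 by lra.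
  by move: x2; rewrite xE; lra.
have cV : (4 + x)^-1 = (4 - x) * (3 / 47).
  apply: (mulfI c0); rewrite divff //.
  have -> : (4 + x) * ((4 - x) * (3 / 47)) = (16 - x ^+ 2) * (3 / 47) by field.
  by rewrite x2; field.
rewrite energy_w_equil // mk_stateZ mk_stateD scaler0 addr0.
congr mk_state.
  by rewrite invfM cV; field; rewrite gt_eqF.
apply/rowP => i; rewrite !mxE -exprVn cV.
have -> : ((4 - x) * (3 / 47)) ^+ 2 =
    (16 - 8 * x + x ^+ 2) * (9 / 2209) by field.
by rewrite x2; field.
Qed.

Lemma w_slope_neq0 : dot w_slope w_slope != 0.
Proof.
rewrite dot_eq0; apply/eqP => /(congr1 (@pres R d ns)).
rewrite pres_mk /pres !mxE => /eqP; rewrite oppr_eq0 gt_eqF //.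
by rewrite divr_gt0 // mulr_gt0.
Qed.

End Mixture.

(** * The discretization and the density ramp *)

Section Scheme.
Variables (R : realType) (R0 : R) (n s : nat).
Hypothesis R0_gt0 : 0 < R0.
Local Notation d := n.+1.
Local Notation ns := s.+1.
Local Notation m := (d + 1 + ns)%N.
Local Notation state := (state R d ns).
Local Notation X := (quad_mix R0 s).
Local Notation equil := (equil_state R0 n s).
Local Notation jump_face := (jump_face n).

Definition wave_bound (y : state) (v : 'rV[R]_d) : R :=
  `|dot (vel X y) v| + Num.sqrt (sound2 R0 X y).

(** The sum of the two bounds required of an estimate stays one when some k >= 0
    is added: this is the freedom that the counterexamples use. *)
Definition shifted_lam (k : R) (yp ym : state) (v : 'rV[R]_d) : R :=
  wave_bound yp v + wave_bound ym v + k.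

Definition cube_disc (k : R) : discretization R d ns :=
  @Discretization R d ns (cube 0) (fun f => cube (2 *: face_nrm R f)) 1 d.+1
    (@p1_basis R d) (@p1_node R d) #|{ffun 'I_d -> bool}|
    (fun q => gauss_pt R (enum_val q)) (const_mx 1) (shifted_lam k).

Lemma wave_bound_ge0 y v : 0 <= wave_bound y v.
Proof. by rewrite addr_ge0 ?sqrtr_ge0. Qed.

Lemma shifted_lam_wave_speed k :
  0 <= k -> wave_speed_estimate R0 X (shifted_lam k).
Proof.
move=> k0 yp ym v _ _ _; split.
  by rewrite /shifted_lam -addrA lerDl addr_ge0 ?wave_bound_ge0.
by rewrite /shifted_lam addrAC lerDr addr_ge0 ?wave_bound_ge0.
Qed.

Lemma p1_node_in_cube j : pts (cube 0) (@p1_node R d j).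
Proof.
apply/pts_cubeP => i; rewrite mxE subr0 /p1_node.
case: (unlift ord0 j) => [k|]; rewrite !mxE ?normr0 //.
by case: (_ && _); rewrite ?normr1 ?normr0.
Qed.

Lemma sum_gauss (F : 'rV[R]_d -> R) :
  \sum_(q < #|{ffun 'I_d -> bool}|) F (gauss_pt R (enum_val q)) =
  \sum_(e : {ffun 'I_d -> bool}) F (gauss_pt R e).
Proof. by rewrite -(big_enum_val (fun e => F (gauss_pt R e))). Qed.

Lemma wf_cube_disc k : 0 <= k -> wf_discretization R0 X (cube_disc k).
Proof.
move=> k0; split.
- split.
  + exact: wf_cube.
  + by move=> f; exact: wf_cube.
  + by move=> f; exists (f.1, ~~ f.2); exact: (cube_facet_nbr R f).
  + by move=> f g; exact: cube_nbr_disjoint.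
- split.
  + exact: p1_basis_deg.
  + move=> q /affine_surj ->; rewrite affine_p1E.
    by eexists.
  + exact: p1_node_in_cube.
  + exact: p1_basis_node.
- split.
  + move=> q; apply/pts_cubeP => i; rewrite !mxE subr0 normrM normr_sign mul1r.
    exact: gauss_abs_le1.
  + by move=> q; rewrite mxE.
  + move=> g g2; rewrite cell_int_cube // -sum_gauss.
    by apply: eq_bigr => q _; rewrite mxE mul1r.
- exact: shifted_lam_wave_speed.
Qed.

Definition ramp_Y : 'M[R]_(d.+1, m) :=
  \matrix_(j < d.+1) equil (4 + @p1_node R d j 0 ord0).

(** The neighbors continue the ramp C = 4 + x_0, except across x_0 = 1. *)
Definition ramp_Z (f : 'I_d * bool) (a : 'I_m) : mpoly d R :=
  if f == jump_face then mpolyC d (equil 1 0 a)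
  else affine (equil 4 0 a) (equil_dir R n s 0 a *: delta_mx 0 ord0).

Lemma p1_interp_row (A B : 'rV[R]_m) (x : 'rV[R]_d) :
  \sum_j ev (p1_basis R j) x *: (A + @p1_node R d j 0 ord0 *: B) =
  A + x 0 ord0 *: B.
Proof.
apply/rowP => a; rewrite summxE !mxE.
have := p1_basis_affine (A 0 a) (B 0 a *: delta_mx 0 ord0) x.
rewrite dotC dotZr dotC dot_delta [B 0 a * _]mulrC => <-.
apply: eq_bigr => j _; rewrite !mxE dotC dotZr dotC dot_delta.
by rewrite mulrC [B 0 a * _]mulrC.
Qed.

Lemma ramp_Y_row j :
  row j ramp_Y = equil 4 + @p1_node R d j 0 ord0 *: equil_dir R n s.
Proof. by rewrite rowK equil_stateD. Qed.

Lemma ramp_y_in k x : y_in (D := cube_disc k) ramp_Y x = equil (4 + x 0 ord0).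
Proof.
rewrite equil_stateD -p1_interp_row; apply/rowP => a.
rewrite mxE /expand ev_sum summxE; apply: eq_bigr => j _.
by rewrite evZ mulrC -ramp_Y_row !mxE.
Qed.

Lemma ramp_y_out k f x : y_out (D := cube_disc k) ramp_Z f x =
  equil (if f == jump_face then 1 else 4 + x 0 ord0).
Proof.
rewrite /y_out /ramp_Z; apply/rowP => a; rewrite mxE; case: ifP => _.
  by rewrite evC.
rewrite ev_affine dotC dotZr dotC dot_delta (equil_stateD _ _ _ 4).
by rewrite [RHS]mxE [X in _ = _ + X]mxE mulrC.
Qed.

(** On the element C lies in [3, 5], and on the neighbors in [1, 5]. *)
Lemma ramp_everywhere k (Q : state -> Prop) :
  (forall C, 0 < C -> Q (equil C)) ->
  everywhere (D := cube_disc k) ramp_Y ramp_Z Q.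
Proof.
move=> hQ; split=> [x /pts_cubeP x1|f x /pts_cubeP xf].
  rewrite ramp_y_in; apply: hQ; have := x1 ord0.
  by rewrite mxE subr0 ler_norml => /andP[]; lra.
rewrite ramp_y_out; apply: hQ; case: ifP => // _.
have := xf ord0; rewrite !mxE eqxx /=.
case: f {xf} => i [] /=; case: (ord0 == i); rewrite /= ?expr0 ?expr1 ler_norml;
  by move=> /andP[]; lra.
Qed.

(** Two Gauss points that differ in one coordinate determine the slope in that
    coordinate, so affine functions are determined by their Gauss values; this
    makes the mass matrix invertible. *)
Lemma p1_gauss_inj (f : 'I_d.+1 -> R) :
  (forall e : {ffun 'I_d -> bool},
     \sum_j f j * ev (p1_basis R j) (gauss_pt R e) = 0) -> forall j, f j = 0.
Proof.
move=> f0; pose e0 := [ffun _ : 'I_d => false].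
have a0 : gauss_abs R != 0.
  by apply/eqP => a0; have := gauss_abs2 R; rewrite a0; lra.
have fi i : f (lift ord0 i) = f ord0.
  have h0 := f0 e0; have h1 := f0 [ffun k => k == i].
  rewrite p1_basis_interp (bigD1 i) //= !mxE ffunE expr0 mul1r in h0.
  rewrite p1_basis_interp (bigD1 i) //= !mxE ffunE eqxx expr1 mulN1r in h1.
  have e01 : \sum_(k | k != i) (f (lift ord0 k) - f ord0) *
      gauss_pt R [ffun k => k == i] 0 k =
    \sum_(k | k != i) (f (lift ord0 k) - f ord0) * gauss_pt R e0 0 k.
    by apply: eq_bigr => k ki; rewrite !mxE !ffunE (negbTE ki).
  rewrite e01 in h1; apply/eqP; rewrite -subr_eq0 -(mulIr_eq0 _ (mulIf a0)).
  by apply/eqP; lra.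
have f00 : f ord0 = 0.
  have := f0 e0; rewrite p1_basis_interp big1 ?addr0 // => i _.
  by rewrite fi subrr mul0r.
by move=> j; case: (unliftP ord0 j) => [i ->|->]; rewrite ?fi.
Qed.

Lemma cube_massE k : mass (cube_disc k) =
  (Vq (cube_disc k))^T *m Vq (cube_disc k).
Proof.
apply/matrixP => i j; rewrite !mxE.
transitivity (cell_int (cube 0) (ev (p1_basis R i * p1_basis R j))).
  by congr (int_Rn _); apply/funext => x /=; rewrite /ev mevalM.
rewrite cell_int_cube; last exact: p1_basis_mul_deg.
rewrite -(sum_gauss (ev (p1_basis R i * p1_basis R j))).
by apply: eq_bigr => q _; rewrite !mxE /ev mevalM.
Qed.

Lemma cube_mass_unit k : mass (cube_disc k) \in unitmx.
Proof.
rewrite -row_free_unit; apply: inj_row_free => u.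
rewrite cube_massE mulmxA => uV.
have dotE (v : 'rV[R]_(nq (cube_disc k))) : dot v v = (v *m v^T) 0 0.
  by rewrite mxE; apply: eq_bigr => i _; rewrite mxE.
have /eqP : dot (u *m (Vq (cube_disc k))^T) (u *m (Vq (cube_disc k))^T) = 0.
  by rewrite dotE trmx_mul trmxK mulmxA uV mul0mx mxE.
rewrite dot_eq0 => /eqP u0; apply/rowP => j; rewrite [RHS]mxE.
apply: (p1_gauss_inj (f := fun j => u 0 j)) => e.
have := congr1 (fun v : 'rV_ _ => v 0 (enum_rank e)) u0.
rewrite !mxE => h; rewrite -[RHS]h; apply: eq_bigr => i _.
by rewrite !mxE /= enum_rankK.
Qed.

(** w is affine at the quadrature points, so its projection is the affine
    function with the same values there. *)
Lemma ramp_what k j : row j (what R0 X (D := cube_disc k) ramp_Y) =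
  w_mean R0 n s + @p1_node R d j 0 ord0 *: w_slope R0 n s.
Proof.
pose T : 'M[R]_(d.+1, m) :=
  \matrix_j (w_mean R0 n s + @p1_node R d j 0 ord0 *: w_slope R0 n s).
suff -> : what R0 X (D := cube_disc k) ramp_Y = T by rewrite rowK.
rewrite /what /=.
have rowV A B (M : 'M[R]_(d.+1, m)) q :
    (forall j, row j M = A + @p1_node R d j 0 ord0 *: B) ->
    row q (Vq (cube_disc k) *m M) = A + gauss_pt R (enum_val q) 0 ord0 *: B.
  move=> hM; rewrite row_mul mulmx_sum_row -p1_interp_row.
  apply: eq_bigr => i _.
  by rewrite hM !mxE.
have -> : \matrix_(q < nq (cube_disc k))
      energy_w R0 X (row q (Vq (cube_disc k) *m ramp_Y)) =
    Vq (cube_disc k) *m T.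
  apply/row_matrixP => q; rewrite rowK (rowV _ _ _ _ ramp_Y_row) -equil_stateD.
  rewrite energy_w_affine ?gauss_pt_sqr //; symmetry; apply: rowV => i.
  by rewrite rowK.
rewrite /= diag_const_mx mulmx1 -!mulmxA [in X in _ *m X]mulmxA -cube_massE.
by rewrite mulKmx // cube_mass_unit.
Qed.

End Scheme.

(** * The effect of the wave speed estimate *)

Section Drift.
Variables (R : realType) (R0 : R) (n s : nat).
Hypothesis R0_gt0 : 0 < R0.
Local Notation d := n.+1.
Local Notation ns := s.+1.
Local Notation m := (d + 1 + ns)%N.
Local Notation state := (state R d ns).
Local Notation X := (quad_mix R0 s).
Local Notation equil := (equil_state R0 n s).
Local Notation jump_face := (jump_face n).
Local Notation disc := (cube_disc R0 n s).
Local Notation Y := (ramp_Y R0 n s).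
Local Notation Z := (ramp_Z R0 (n := n) (s := s)).
Local Notation jump := (equil 5 - equil 1).
Local Notation node1 := (lift ord0 ord0 : 'I_d.+1).

Lemma jump_face_coord x :
  facet (K := cube (0 : 'rV[R]_d)) jump_face x -> x 0 ord0 = 1.
Proof. by case=> _; rewrite /= dot0 addr0 face_nrm_jump_face dot_delta. Qed.

(** Over the face x_0 = 1 the mean of a basis function is its value at the
    center (1, 0, ..., 0) of the face, which is the node of index node1. *)
Lemma facet_int_p1 j (a : R) :
  facet_int (K := cube (0 : 'rV[R]_d)) jump_face
    (fun x => ev (p1_basis R j) x * a) =
  a * (j == node1)%:R * 2 ^+ n.
Proof.
have [b [c [-> <-]]] : exists b c, p1_basis R j = affine b c /\
    b + c 0 ord0 = (j == node1)%:R.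
  rewrite /p1_basis; case: (unliftP ord0 j) => [i ->|->].
    exists 0, (delta_mx 0 i); split=> //.
    by rewrite add0r mxE eqxx (inj_eq lift_inj) eq_sym.
  by exists 1, (const_mx (-1)); split=> //; rewrite mxE subrr.
rewrite -facet_int_jump_face_affine; congr facet_int.
by apply/funext => x; rewrite ev_affine mulrC.
Qed.

Lemma num_flux_shift k (yp ym : state) (v : 'rV[R]_d) :
  num_flux X (shifted_lam R0 k) yp ym v =
  num_flux X (shifted_lam R0 0) yp ym v + (2^-1 * k) *: (yp - ym).
Proof.
by rewrite /num_flux -addrA -scalerDl /shifted_lam addr0 -mulrDr.
Qed.

Lemma num_energy_flux_shift k (yp ym : state) (v : 'rV[R]_d) :
  num_energy_flux R0 X (shifted_lam R0 k) yp ym v =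
  num_energy_flux R0 X (shifted_lam R0 0) yp ym v
  + 2^-1 * k * (rho_et R0 X yp - rho_et R0 X ym).
Proof. by rewrite /num_energy_flux /shifted_lam addr0; ring. Qed.

(** Where the traces agree the dissipation vanishes pointwise, so the two
    integrands can be compared without being integrable; on jump_face both are
    polynomial. *)
Lemma boundary_int_shift (g h : 'I_d * bool -> 'rV[R]_d -> R) (c : R) :
  (forall f x, f != jump_face -> g f x = h f x) ->
  facet_int (K := cube (0 : 'rV[R]_d)) jump_face (g jump_face) =
    facet_int (K := cube (0 : 'rV[R]_d)) jump_face (h jump_face) + c ->
  boundary_int (K := cube 0) g = boundary_int (K := cube 0) h + c.
Proof.
move=> gh gh1; rewrite /boundary_int (bigD1 jump_face) //= gh1.
rewrite [in RHS](bigD1 jump_face) //=.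
rewrite addrAC; congr (_ + _ + _); apply: eq_bigr => f f1.
by apply: eq_facet_int => x _; exact: gh.
Qed.

Lemma residual_shift k j :
  residual R0 X (D := disc k) Y Z j = residual R0 X (D := disc 0) Y Z j
  + (2^-1 * k * (j == node1)%:R * 2 ^+ n) *: jump.
Proof.
have shift : boundary_intv (fun (f : face (elt (disc k))) x =>
    ev (phi (disc k) j) x *: num_flux X (shifted_lam R0 k)
      (y_in (D := disc k) Y x) (y_out (D := disc k) Z f x) (nrm f)) =
  boundary_intv (fun (f : face (elt (disc 0))) x =>
    ev (phi (disc 0) j) x *: num_flux X (shifted_lam R0 0)
      (y_in (D := disc 0) Y x) (y_out (D := disc 0) Z f x) (nrm f))
  + (2^-1 * k * (j == node1)%:R * 2 ^+ n) *: jump.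
  apply/rowP => a; rewrite ![in LHS]mxE [RHS]mxE [X in X + _]mxE.
  apply: boundary_int_shift => [f x f1|].
    rewrite !ramp_y_in !ramp_y_out (negbTE f1) num_flux_shift.
    by rewrite subrr scaler0 addr0.
  pose nf k :=
    num_flux X (shifted_lam R0 k) (equil 5) (equil 1)
      (face_nrm R jump_face) 0 a.
  have faceE k' : facet_int (K := cube (0 : 'rV[R]_d)) jump_face (fun x =>
    (ev (phi (disc k') j) x *: num_flux X (shifted_lam R0 k')
      (y_in (D := disc k') Y x) (y_out (D := disc k') Z jump_face x)
      (face_nrm R jump_face)) 0 a) = nf k' * (j == node1)%:R * 2 ^+ n.
    rewrite -facet_int_p1; apply: eq_facet_int => x /jump_face_coord x1.
    rewrite mxE ramp_y_in ramp_y_out eqxx x1 /nf.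
    by rewrite (_ : 4 + 1 = 5 :> R); last by ring.
  rewrite !faceE /nf num_flux_shift.
  by move: (num_flux _ _ _ _ _) (jump) => N J; rewrite !mxE; ring.
by rewrite /residual shift -!addrA; congr (_ + _); rewrite addrC -!addrA.
Qed.

(** How far the projected w, taken at the center of the jump face, is from
    satisfying the discrete chain rule: jump of rho e_t = w . jump of y. *)
Definition energy_defect : R := rho_et R0 X (equil 5) - rho_et R0 X (equil 1)
  - dot (w_mean R0 n s + w_slope R0 n s) jump.

Lemma equil_jump :
  jump = mk_state (4 *: delta_mx 0 ord0) 0 (4 *: delta_mx 0 ord0).
Proof.
rewrite mk_stateB subrr -!scalerBl; congr mk_state; congr (_ *: _); ring.
Qed.

(** Its value is - 4 / 5 + 300 / 2209: the exact 1 / (5 * 1) against the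
    projected value 75 / 2209 of 1 / C^2, times the jump 4. *)
Lemma energy_defect_neq0 : energy_defect != 0.
Proof.
rewrite /energy_defect !rho_et_equil // equil_jump mk_stateD dot_mk.
rewrite mom_mk pres_mk conc_mk mulr0 !addr0 !dotZr.
rewrite [dot (const_mx _ + _) _]dotC !dot_delta.
rewrite !mxE !eqxx /=.
by apply/eqP; lra.
Qed.

Lemma p1_node_sum : \sum_(j < d.+1) @p1_node R d j 0 ord0 = 1.
Proof.
rewrite big_ord_recl /p1_node unlift_none mxE add0r.
rewrite big_ord_recl liftK mxE !eqxx.
by rewrite big1 ?addr0 // => i _; rewrite liftK mxE eqxx.
Qed.

Lemma ramp_wbar k : wbar R0 X (D := disc k) Y =
  w_mean R0 n s + d.+1%:R^-1 *: w_slope R0 n s.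
Proof.
rewrite /wbar (eq_bigr _ (fun j _ => ramp_what R0_gt0 (k := k) j)).
rewrite big_split /= sumr_const card_ord -scaler_suml p1_node_sum scale1r.
rewrite scalerDr -(scaler_nat _ (w_mean R0 n s)) scalerA.
by rewrite mulVf ?scale1r ?pnatr_eq0.
Qed.

Lemma what_deviation k j :
  row j (what R0 X (D := disc k) Y) - wbar R0 X (D := disc k) Y =
  (@p1_node R d j 0 ord0 - d.+1%:R^-1) *: w_slope R0 n s.
Proof.
by rewrite ramp_what // ramp_wbar opprD addrACA subrr add0r -scalerBl.
Qed.

Lemma node1_deviation : @p1_node R d node1 0 ord0 - d.+1%:R^-1 != 0 :> R.
Proof.
by rewrite /p1_node liftK mxE !eqxx subr_eq0 eq_sym invr_eq1 pnatr_eq1.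
Qed.

Lemma ramp_alpha_den_neq0 k : alpha_den R0 X (D := disc k) Y != 0.
Proof.
have sq j : dot (row j (what R0 X (D := disc k) Y) - wbar R0 X (D := disc k) Y)
    (row j (what R0 X (D := disc k) Y) - wbar R0 X (D := disc k) Y) =
    (@p1_node R d j 0 ord0 - d.+1%:R^-1) ^+ 2 *
    dot (w_slope R0 n s) (w_slope R0 n s).
  by rewrite what_deviation dotZr dotC dotZr mulrA.
rewrite /alpha_den (eq_bigr _ (fun j _ => sq j)) -mulr_suml.
rewrite mulf_neq0 ?w_slope_neq0 // psumr_neq0 => [|j _]; last exact: sqr_ge0.
apply/hasP; exists node1; rewrite ?mem_index_enum //=.
by rewrite lt0r sqr_ge0 sqrf_eq0 node1_deviation.
Qed.

(** The dissipation enters the numerator of alpha through the energy flux and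
    through the residual tested with the projected w.  The former is constant on
    the jump face; the latter is affine there, and its mean is its value at
    node1.  The factor 2^n is the area of the face. *)
Lemma alpha_shift k :
  alpha R0 X (D := disc k) Y Z = alpha R0 X (D := disc 0) Y Z +
  2^-1 * k * 2 ^+ n * energy_defect / alpha_den R0 X (D := disc 0) Y.
Proof.
have fluxE : boundary_int (fun (f : face (elt (disc k))) x =>
     num_energy_flux R0 X (Defs.lam (disc k)) (y_in (D := disc k) Y x)
      (y_out (D := disc k) Z f x) (nrm f)) =
   boundary_int (fun (f : face (elt (disc 0))) x =>
     num_energy_flux R0 X (Defs.lam (disc 0)) (y_in (D := disc 0) Y x)
      (y_out (D := disc 0) Z f x) (nrm f))
   + 2^-1 * k * 2 ^+ n * (rho_et R0 X (equil 5) - rho_et R0 X (equil 1)).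
  apply: boundary_int_shift => [f x f1|].
    rewrite !ramp_y_in !ramp_y_out (negbTE f1) /=.
    by rewrite num_energy_flux_shift subrr mulr0 addr0.
  pose nf k := num_energy_flux R0 X (shifted_lam R0 k) (equil 5) (equil 1)
    (face_nrm R jump_face).
  have faceE k' : facet_int (K := cube (0 : 'rV[R]_d)) jump_face (fun x =>
    num_energy_flux R0 X (shifted_lam R0 k')
      (y_in (D := disc k') Y x) (y_out (D := disc k') Z jump_face x)
      (face_nrm R jump_face)) = nf k' * 2 ^+ n.
    transitivity (facet_int (K := cube (0 : 'rV[R]_d)) jump_face
      (fun x => nf k' * (1 + dot 0 x))).
      apply: eq_facet_int => x /jump_face_coord x1.
      rewrite ramp_y_in ramp_y_out eqxx x1 dotC dot0 addr0 mulr1 /nf.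
      by rewrite (_ : 4 + 1 = 5 :> R); last by ring.
    by rewrite facet_int_jump_face_affine mxE addr0 mulr1.
  by rewrite !faceE /nf num_energy_flux_shift; ring.
have workE : \sum_j dot (row j (what R0 X (D := disc k) Y))
      (residual R0 X (D := disc k) Y Z j) =
    \sum_j dot (row j (what R0 X (D := disc 0) Y))
      (residual R0 X (D := disc 0) Y Z j)
    + 2^-1 * k * 2 ^+ n * dot (w_mean R0 n s + w_slope R0 n s) jump.
  transitivity (\sum_j (dot (row j (what R0 X (D := disc 0) Y))
      (residual R0 X (D := disc 0) Y Z j) +
      2^-1 * k * (j == node1)%:R * 2 ^+ n *
      dot (row j (what R0 X (D := disc 0) Y)) jump)).
    by apply: eq_bigr => j _; rewrite residual_shift dotDr dotZr.
  rewrite big_split /=; congr (_ + _).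
  rewrite (bigD1 node1) //= big1 => [|j j1].
    by rewrite ramp_what // /p1_node liftK mxE !eqxx scale1r; ring.
  by rewrite (negbTE j1) mulr0 !mul0r.
rewrite /alpha -mulrDl; congr (_ / _).
apply: etrans (congr2 (fun a b => a - b) fluxE workE) _.
by rewrite /energy_defect; ring.
Qed.

Definition ramp_rate k : 'M[R]_(d.+1, m) := - (invmx (mass (disc k)) *m
  \matrix_j (residual R0 X (D := disc k) Y Z j +
             correction R0 X (D := disc k) Y Z j)).

Lemma mass_ramp_rate k j :
  \sum_i mass (disc k) j i *: row i (ramp_rate k) =
  - (residual R0 X (D := disc k) Y Z j + correction R0 X (D := disc k) Y Z j).
Proof.
transitivity (row j (mass (disc k) *m ramp_rate k)).
  by rewrite row_mul mulmx_sum_row; apply: eq_bigr => i _; rewrite [in RHS]mxE.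
by rewrite mulmxN mulKVmx ?cube_mass_unit // linearN /= rowK.
Qed.

Lemma ramp_semi_discretization k :
  semi_discretization R0 X (D := disc k) Y Z (ramp_rate k).
Proof. by move=> j; rewrite mass_ramp_rate -addrA addNr. Qed.

(** The balances at node1 for k = 0 and k = 1 are compared; the residuals have
    the same image under l because l kills the jump, so only alpha changes. *)
Lemma ramp_drift (l : state) : dot l (w_slope R0 n s) != 0 -> dot l jump = 0 ->
  exists k j, 0 <= k /\ dot l (row j (ramp_rate k)) != 0.
Proof.
move=> lw lj; apply: contrapT => none.
have l0 k j : 0 <= k -> dot l (row j (ramp_rate k)) = 0.
  by move=> k0; apply/eqP; apply: contrapT => /negP ?; apply: none; exists k, j.
have balance k : 0 <= k ->
    dot l (residual R0 X (D := disc k) Y Z node1) +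
    alpha R0 X (D := disc k) Y Z *
      ((@p1_node R d node1 0 ord0 - d.+1%:R^-1) * dot l (w_slope R0 n s)) = 0.
  move=> k0; rewrite -dotZr -(what_deviation (k := k) node1) -dotZr -dotDr.
  apply/eqP; rewrite -oppr_eq0 -dotNr -mass_ramp_rate; apply/eqP.
  rewrite (big_morph (dot l) (dotDr l) (dot0 l)) big1 // => i _.
  by rewrite dotZr l0 ?mulr0.
have := balance 1 ler01.
rewrite residual_shift alpha_shift dotDr dotZr lj mulr0.
rewrite addr0 mulrDl addrA balance // add0r => /eqP; apply/negP.
rewrite mulr1 !mulf_neq0 ?invr_eq0 ?expf_neq0 ?energy_defect_neq0
  ?ramp_alpha_den_neq0 ?node1_deviation //.
all: by rewrite ?invr_eq0 pnatr_eq0.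
Qed.

End Drift.

(** * Failure of the three properties *)

Section Failure.
Variables (R : realType) (R0 : R) (n s : nat).
Hypothesis R0_gt0 : 0 < R0.
Local Notation d := n.+1.
Local Notation ns := s.+1.
Local Notation state := (state R d ns).
Local Notation X := (quad_mix R0 s).
Local Notation equil := (equil_state R0 n s).
Local Notation disc := (cube_disc R0 n s).
Local Notation Y := (ramp_Y R0 n s).
Local Notation Z := (ramp_Z R0 (n := n) (s := s)).
Local Notation jump := (equil 5 - equil 1).

Lemma ramp_admissible k : admissible R0 X (D := disc k) Y Z.
Proof.
split; last exact: ramp_alpha_den_neq0.
  move=> f a; rewrite /ramp_Z; case: ifP => _; last exact: affine_deg.
  by rewrite /deg_le msizeC; case: eqP.
by apply: ramp_everywhere => C; exact: physical_equil.
Qed.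

Lemma ramp_equilibrium k : equilibrium X (D := disc k) Y Z.
Proof.
exists R0, (delta_mx 0 ord0); apply: ramp_everywhere => C C0.
by rewrite pres_equil vel_equil // gt_eqF.
Qed.

Lemma dt_state_node k (dY : 'M[R]_(d.+1, d + 1 + ns)) j :
  dt_state (D := disc k) dY (@p1_node R d j) = row j dY.
Proof.
apply/rowP => a; rewrite !mxE /expand ev_sum (bigD1 j) //= big1 => [|i ij].
  by rewrite evZ p1_basis_node eqxx mulr1 addr0.
by rewrite evZ p1_basis_node eq_sym (negbTE ij) mulr0.
Qed.

Lemma not_pressure_preserving : ~ pressure_equilibrium_preserving R0 d ns.
Proof.
move=> pp.
have [||k [j [k0]]] := ramp_drift R0_gt0 (l := mk_state 0 1 0 : state).
- rewrite dot_mk mom_mk pres_mk conc_mk dot0 dotC dot0 add0r addr0 mul1r.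
  by rewrite oppr_eq0 gt_eqF // divr_gt0 // mulr_gt0.
- rewrite equil_jump dot_mk mom_mk pres_mk conc_mk dotC dot0.
  by rewrite [dot 0 _]dotC dot0 mulr0 !addr0.
have := pp X (disc k) Y Z (ramp_rate R0 n s k) (wf_quad_mix R0 s)
  (wf_cube_disc R0 n s k0) (ramp_admissible k)
  (@ramp_semi_discretization R R0 n s k)
  (ramp_equilibrium k) _ (@p1_node_in_cube R n j).
rewrite dt_state_node dot_mk dotC dot0 [dot 0 _]dotC dot0.
rewrite add0r addr0 mul1r => ->.
by rewrite eqxx.
Qed.

Lemma not_velocity_preserving : ~ velocity_equilibrium_preserving R0 d ns.
Proof.
move=> vp.
have cE (y : state) : dot (const_mx (-1)) (conc y) = - rho X y.
  by rewrite /dot /rho -sumrN; apply: eq_bigr => i _; rewrite mxE mul1r mulN1r.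
have [||k [j [k0]]] := ramp_drift R0_gt0
  (l := mk_state (delta_mx 0 ord0) 0 (const_mx (-1)) : state).
- rewrite dot_mk mom_mk pres_mk dot0 mul0r !add0r cE oppr_eq0.
  rewrite rho_quad_mix /csum.
  have c0 : 0 < 72 / 2209 :> R by lra.
  under eq_bigr do rewrite conc_mk mxE.
  move: (72 / 2209) c0 => c c0.
  by rewrite sumr_const card_ord mulrn_eq0 negb_or /= gt_eqF.
- rewrite dot_mk cE equil_jump mom_mk pres_mk mulr0 addr0 dotZr dot_delta_self.
  rewrite rho_quad_mix /csum conc_mk (bigD1 ord0) //= big1 => [|i i0].
    by rewrite !mxE !eqxx mulr1 addr0 subrr.
  by rewrite !mxE (negbTE i0) andbF mulr0.
have := vp X (disc k) Y Z (ramp_rate R0 n s k) (wf_quad_mix R0 s)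
  (wf_cube_disc R0 n s k0) (ramp_admissible k)
  (@ramp_semi_discretization R R0 n s k)
  (ramp_equilibrium k) _ (@p1_node_in_cube R n j).
rewrite /dt_vel dt_state_node ramp_y_in rho_quad_mix csum_equil.
have C0 : 4 + @p1_node R d j 0 ord0 != 0.
  have /pts_cubeP/(_ ord0) := @p1_node_in_cube R n j.
  by rewrite mxE subr0 ler_norml => /andP[h _]; apply/eqP; lra.
rewrite vel_equil // dot_mk mul0r addr0 cE dot_delta.
move: (mom _) (rho _ _) => u r /rowP/(_ ord0).
rewrite !mxE !eqxx mulr1 mulrC -mulrBl => /eqP.
by rewrite mulf_eq0 invr_eq0 (negbTE C0) orbF => ->.
Qed.

Lemma not_zero_concentration_preserving :
  (0 < s)%N -> ~ zero_concentration_preserving R0 d ns.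
Proof.
move=> s0 cp; pose i : 'I_ns := ord_max.
have i0 : (i == ord0) = false.
  by apply/eqP => /(congr1 val) /= s00; rewrite s00 in s0.
have [||k [j [k0]]] := ramp_drift R0_gt0
  (l := mk_state 0 0 (delta_mx 0 i) : state).
- rewrite dot_mk mom_mk pres_mk dot0 mul0r !add0r dot_delta conc_mk mxE.
  by apply/eqP; lra.
- rewrite equil_jump dot_mk pres_mk dotC dot0 mulr0 !add0r dot_delta conc_mk.
  by rewrite !mxE i0 andbF mulr0.
have := cp X (disc k) Y Z (ramp_rate R0 n s k) (wf_quad_mix R0 s)
  (wf_cube_disc R0 n s k0) (ramp_admissible k)
  (@ramp_semi_discretization R R0 n s k)
  i _ _ (@p1_node_in_cube R n j).
rewrite dt_state_node dot_mk dotC dot0 mul0r !add0r dot_delta => ->.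
  by rewrite eqxx.
apply: ramp_everywhere => C _.
by rewrite conc_mk !mxE i0 andbF mulr0.
Qed.

End Failure.

Theorem proposition14 (R : realType) (R0 : R) (d ns : nat) (hR0 : 0 < R0)
    (hd : (0 < d)%N) (hns : (0 < ns)%N) :
  ~ velocity_equilibrium_preserving R0 d ns /\
  ~ pressure_equilibrium_preserving R0 d ns /\
  ((1 < ns)%N -> ~ zero_concentration_preserving R0 d ns).
Proof.
case: d hd ns hns => [//|n] _ [//|s] _; split; [|split].
- exact: not_velocity_preserving.
- exact: not_pressure_preserving.
- exact: not_zero_concentration_preserving.
Qed.
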